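(* Let $n\ge1$ be an integer and for $s,t\in\mathbb{R}$ let $A_n(s,t)=\big[\min\{i,j\}+s+t\,\delta_{i,j}\big]_{i,j=1}^n$. Then: (1) $A_n(t,t)$ is positive definite if and only if $t\ge \dfrac{-1}{2+2\cos(\pi/(n+1))}$; (2) $A_n(-1/2,t)$ is positive definite if and only if $t\ge \dfrac{-1}{2+2\cos(\pi/(2n))}$; (3) $A_n(0,t)$ is positive definite if and only if $t\ge \dfrac{-1}{2+2\cos(2\pi/(2n+1))}$; (4) $A_n(2t,t)$ is positive definite if and only if $t\ge \dfrac{-1}{2+2\cos(\pi/(2n+1))}$.
   Context: $\delta_{i,j}$ is the Kronecker delta. ''Positive definite'' means positive semidefinite: all eigenvalues of the real symmetric matrix are $\ge0$. *)

(* Defs.v *)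
From mathcomp Require Import all_boot all_order all_algebra.
From mathcomp Require Import reals trigo.

Set Implicit Arguments.
Unset Strict Implicit.
Unset Printing Implicit Defensive.

Import Order.TTheory GRing.Theory Num.Theory.
Local Open Scope ring_scope.

(* Indices are 0-based: the entry at (i, j) : 'I_n * 'I_n is the one that is
   usually numbered (i + 1, j + 1). *)
Definition shifted_min_mx (R : realType) (n : nat) (s t : R) : 'M[R]_n :=
  \matrix_(i < n, j < n) ((minn i.+1 j.+1)%:R + s + t * (i == j)%:R).

(* "Positive definite" is meant in the weak sense (eigenvalues >= 0). The
   eigenvalues of a real symmetric matrix are all real, so quantifying over R
   misses none of them. *)
Definition posdefmx (R : realType) (n : nat) (A : 'M[R]_n) : Prop :=
  A \is symmetricmx /\ (forall a : R, eigenvalue A a -> 0 <= a).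

(* Main.v *)
Require Import Defs.
From mathcomp Require Import all_boot all_order all_algebra.
From mathcomp Require Import reals trigo.
From mathcomp Require Import complex zify ring lra.

Set Implicit Arguments.
Unset Strict Implicit.
Unset Printing Implicit Defensive.

Import Order.TTheory GRing.Theory Num.Theory.
Local Open Scope ring_scope.

(* By the spectral theorem over R[i], the eigenvalues are nonnegative exactly when
   the quadratic form is. In terms of the sums w_j of the last j coordinates
   of x, the quadratic form of A_n(s, t) is
     sum_(1 <= j <= n) w_j^2 + s w_n^2 + t sum_(0 <= j < n) (w_(j+1) - w_j)^2
   with w_0 = 0. For s = c t - d it reads Q(w) + t S(w) where Q is a positive
   diagonal form and S is tridiagonal, so it is nonnegative exactly when
   t >= -1 / lambda, with lambda the maximum of S / Q. This maximum is attained at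
   w_j = (-1)^j sin(j theta), where lambda = 2 + 2 cos(theta) and the equation at
   j = n determines theta in each of the four cases. *)

(** * Eigenvalues and the quadratic form *)

Lemma mulmx_rV_tr (R : realDomainType) (n : nat) (x : 'rV[R]_n) :
  (x *m x^T) 0 0 = \sum_i x 0 i ^+ 2.
Proof. by rewrite mxE; apply: eq_bigr => i _; rewrite mxE -expr2. Qed.

Lemma qform_ge0_eigenvalue (R : realFieldType) (n : nat) (A : 'M[R]_n) (a : R) :
  (forall x : 'rV_n, 0 <= (x *m A *m x^T) 0 0) -> eigenvalue A a -> 0 <= a.
Proof.
move=> A_ge0 /eigenvalueP [x xA x_neq0].
have := A_ge0 x; rewrite xA -scalemxAl mxE mulmx_rV_tr pmulr_lge0 // lt_def.
rewrite sumr_ge0 ?andbT => [|i _]; last exact: sqr_ge0.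
apply: contra x_neq0; rewrite psumr_eq0 => [/allP x0|i _]; last exact: sqr_ge0.
apply/eqP/rowP => i; rewrite mxE; apply/eqP.
by rewrite -sqrf_eq0; apply: x0; rewrite mem_index_enum.
Qed.

(** Over [R[i]] the matrix is Hermitian, so in a unitary eigenbasis the form is the sum of the
    [D 0 i] times squared moduli of the coordinates. *)
Lemma eigenvalue_ge0_qform (R : rcfType) (n : nat) (A : 'M[R]_n) :
  A \is symmetricmx -> (forall a : R, eigenvalue A a -> 0 <= a) ->
  forall x : 'rV_n, 0 <= (x *m A *m x^T) 0 0.
Proof.
move=> A_sym A_ge0 x.
pose toC := real_complex R.
pose B : 'M[R[i]]_n := map_mx toC A.
have realC m p (M : 'M[R]_(m, p)) : map_mx toC M \is a realmx.
  by apply/mxOverP => i j; rewrite mxE; apply/complex_realP; exists (M i j).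
have B_herm : B \is hermsymmx.
  apply: realsym_hermsym (realC _ _ A).
  apply/is_hermitianmxP; rewrite expr0 scale1r map_mx_id //.
  have /is_hermitianmxP := A_sym; rewrite expr0 scale1r map_mx_id // => A_tr.
  by rewrite /B {1}A_tr map_trmx.
have := hermitian_spectral_diag_real B_herm.
have /hermitian_normalmx /orthomx_spectralP := B_herm.
have := spectral_unitarymx B.
set P := spectralmx B; set D := spectral_diag B => P_unitary B_eq D_real.
have D_ge0 i : 0 <= D 0 i.
  have /complex_realP [d Dd] := mxOverP D_real 0 i.
  (* The real number [d] is an eigenvalue of [A] over [R] as soon as it is one of [B]; row [i] of
     [P] is an eigenvector. *)
  rewrite Dd ler0c; apply: A_ge0; rewrite -(eigenvalue_map toC).
  have P_unit := unitarymx_unit P_unitary.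
  apply/eigenvalueP; exists (row i P).
    rewrite -[RHS]/(d%:C%C *: row i P) -Dd -/B -row_mul.
    rewrite {1}B_eq mulmxA mulKVmx //.
    by apply/rowP => j; rewrite mul_diag_mx !mxE.
  apply/eqP => rowP0; have := congr1 (fun M => row i M 0 i) (mulmxV P_unit).
  by rewrite row_mul rowP0 mul0mx !mxE eqxx => /esym/eqP; rewrite oner_eq0.
rewrite -ler0c.
pose u := map_mx toC x *m (P^t*)%sesqui.
have -> : ((x *m A *m x^T) 0 0)%:C%C = \sum_i D 0 i * (u 0 i * (u 0 i)^*).
  have -> : ((x *m A *m x^T) 0 0)%:C%C
      = (map_mx toC x *m B *m map_mx toC x^T) 0 0 by rewrite -!map_mxM [RHS]mxE.
  have -> : map_mx toC x *m B *m map_mx toC x^T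
      = u *m diag_mx D *m (u^t*)%sesqui.
    rewrite B_eq invmx_unitary // /u trmx_mul map_mxM trmxCK !mulmxA.
    by rewrite (map_trmx toC) (realmxC (realC _ _ _)).
  by rewrite mul_mx_diag mxE; apply: eq_bigr => i _; rewrite !mxE mulrAC mulrC.
by apply: sumr_ge0 => i _; rewrite mulr_ge0 // mul_conjC_ge0.
Qed.

Lemma posdefmxP (R : realType) (n : nat) (A : 'M[R]_n) :
  A \is symmetricmx ->
  posdefmx A <-> forall x : 'rV_n, 0 <= (x *m A *m x^T) 0 0.
Proof.
move=> A_sym; split=> [[_ A_ge0]|A_ge0]; first exact: eigenvalue_ge0_qform.
by split=> // a; apply: qform_ge0_eigenvalue.
Qed.

(** * The quadratic form of [shifted_min_mx] in tail sums *)

Lemma shifted_min_mx_sym (R : realType) (n : nat) (s t : R) :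
  shifted_min_mx n s t \is symmetricmx.
Proof.
apply/is_hermitianmxP; rewrite expr0 scale1r map_mx_id //.
by apply/matrixP => i j; rewrite !mxE minnC eq_sym.
Qed.

(* In reversed order, so that [w j] is the sum of the last [j] entries and the
   boundary condition is [w 0 = 0]. *)
Definition diff_row (R : zmodType) (n : nat) (w : nat -> R) : 'rV[R]_n :=
  \row_(i < n) (w (n - i)%N - w (n - i.+1)%N).

Lemma diff_row_surj (R : zmodType) (n : nat) (x : 'rV[R]_n) :
  exists2 w : nat -> R, w 0%N = 0 & x = diff_row n w.
Proof.
(* The condition [n <= i + j] selects the last [j] indices without truncated subtraction. *)
exists (fun j => \sum_(i < n | (n <= i + j)%N) x 0 i).
  by rewrite big1 // => i; rewrite addn0 leqNgt ltn_ord.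
apply/rowP => k; rewrite mxE (bigD1 k) /=; last by have := ltn_ord k; lia.
rewrite -addrA [X in _ + X](_ : _ = 0) ?addr0 //; apply/eqP; rewrite subr_eq0.
apply/eqP/eq_bigl => i; have := ltn_ord k; have := ltn_ord i.
rewrite -val_eqE /=; lia.
Qed.

Lemma sum_diff_row (R : zmodType) (n : nat) (w : nat -> R) (k : nat) :
  w 0%N = 0 -> (k <= n)%N ->
  \sum_(i < n | (k <= i)%N) diff_row n w 0 i = w (n - k)%N.
Proof.
move=> w0 le_kn; under eq_bigr do rewrite mxE.
rewrite -(big_geq_mkord _ _ xpredT (fun i => w (n - i)%N - w (n - i.+1)%N)).
have := telescope_sumr (fun i => w (n - i)%N) le_kn.
rewrite subnn w0 sub0r => /(congr1 -%R); rewrite opprK -sumrN => <-.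
by apply: eq_bigr => i _; rewrite opprB.
Qed.

(** With 0-based indices, [minn i.+1 j.+1] counts the [k] with [k <= i] and [k <= j], which is an
    inner product of two rows of [U]. *)
Lemma shifted_min_mxE (R : realType) (n : nat) (s t : R) :
  let U := \matrix_(i < n, k < n) (k <= i)%N%:R in
  let J : 'rV_n := const_mx 1 in
  shifted_min_mx n s t = U *m U^T + s *: (J^T *m J) + t%:M.
Proof.
move=> U J; apply/matrixP => i j; rewrite !mxE big_ord1 !mxE !mulr1 mulr_natr.
congr (_ + _ + _).
under eq_bigr do rewrite !mxE -natrM mulnb.
rewrite -natr_sum; congr _%:R.
have lt_mn : (minn i j < n)%N by rewrite gtn_min ltn_ord.
rewrite minnSS -[LHS]muln1 -[X in (X * _)%N](card_ord (minn i j).+1).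
rewrite -sum_nat_const (big_ord_widen n (fun=> 1%N) lt_mn) big_mkcond /=.
by apply: eq_bigr => k _; rewrite ltnS leq_min; case: (_ && _).
Qed.

Lemma shifted_min_mx_qform (R : realType) (n : nat) (s t : R) (w : nat -> R) :
  w 0%N = 0 ->
  let x := diff_row n w in
  (x *m shifted_min_mx n s t *m x^T) 0 0 =
  \sum_(j < n) w j.+1 ^+ 2 + s * w n ^+ 2
  + t * \sum_(j < n) (w j.+1 - w j) ^+ 2.
Proof.
move=> w0 x; rewrite shifted_min_mxE.
set U := (X in X *m X^T); set J := const_mx 1.
have xU k : (x *m U) 0 k = w (n - k)%N.
  rewrite mxE -(sum_diff_row w0 (ltnW (ltn_ord k))) [RHS]big_mkcond /=.
  by apply: eq_bigr => i _; rewrite !mxE mulr_natr mulrb.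
have xJ : (x *m J^T) 0 0 = w n.
  rewrite mxE -[in RHS](subn0 n) -(sum_diff_row w0 (leq0n n)).
  by apply: eq_bigr => i _; rewrite !mxE mulr1.
have -> : x *m (U *m U^T + s *: (J^T *m J) + t%:M) *m x^T =
    (x *m U) *m (x *m U)^T + s *: ((x *m J^T) *m (x *m J^T)^T)
    + t *: (x *m x^T).
  rewrite !mulmxDr !mulmxDl !trmx_mul trmxK mul_mx_scalar -scalemxAl.
  by rewrite -scalemxAr -scalemxAl !mulmxA.
have addE (M N : 'M[R]_1) : (M + N) 0 0 = M 0 0 + N 0 0 by rewrite mxE.
have scaleE a (M : 'M[R]_1) : (a *: M) 0 0 = a * M 0 0 by rewrite mxE.
rewrite !addE !scaleE !mulmx_rV_tr big_ord1 xJ.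
congr (_ + _ + t * _); rewrite (reindex_inj rev_ord_inj) /=.
  by apply: eq_bigr => j _; rewrite xU /= subKn.
apply: eq_bigr => j _; rewrite mxE /= -subSn // subSS.
by rewrite !subKn // ltnW.
Qed.

(** * Extremal ratio of the two forms and its trigonometric values *)

(* Ground state substitution: [z] is positive and [(-1) ^+ j * z j] satisfies the
   eigenvector equations of the path Laplacian, for the eigenvalue [2 + mu], at
   all vertices but the last. *)
Lemma sum_sqr_diff_le (R : realFieldType) (mu : R) (z w : nat -> R) (m : nat) :
  z 0%N = 0 -> (forall j, z j.+2 + z j = mu * z j.+1) ->
  w 0%N = 0 -> (forall j, (j <= m)%N -> 0 < z j.+1) ->
  \sum_(j < m.+1) (w j.+1 - w j) ^+ 2 <=
  (2 + mu) * (\sum_(j < m) w j.+1 ^+ 2) + (1 + z m / z m.+1) * w m.+1 ^+ 2.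
Proof.
move=> z0 z_rec w0; elim: m => [|m IHm] z_gt0.
  by rewrite big_ord1 big_ord0 w0 z0; lra.
rewrite big_ord_recr /= [X in _ * X + _]big_ord_recr /=.
have {IHm} := IHm (fun j le_jm => z_gt0 j (leqW le_jm)).
have zm1_gt0 := z_gt0 m (leqnSn m); have zm2_gt0 := z_gt0 m.+1 (leqnn _).
set a := w m.+1; set b := w m.+2 => IHm.
have zm : z m = mu * z m.+1 - z m.+2 by rewrite -z_rec addrC addKr.
(* This square bounds the cross term [-2 * (a * b)] of the new summand; it vanishes when [b / a] is
   [- z m.+2 / z m.+1], as for the alternating sequence. *)
have amgm : 0 <= (z m.+2 * a + z m.+1 * b) ^+ 2 / (z m.+1 * z m.+2).
  by rewrite divr_ge0 ?sqr_ge0 // mulr_ge0 // ltW.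
have amgmE : (z m.+2 * a + z m.+1 * b) ^+ 2 / (z m.+1 * z m.+2) =
    z m.+2 / z m.+1 * a ^+ 2 + 2 * (a * b) + z m.+1 / z m.+2 * b ^+ 2.
  by field; rewrite !gt_eqF.
have zmE : z m / z m.+1 = mu - z m.+2 / z m.+1.
  by rewrite zm mulrBl mulfK // gt_eqF.
move: amgm IHm; rewrite {}amgmE {}zmE.
move: (\sum_(_ < _) _) (\sum_(_ < _) _) (z m.+2 / _) (z m.+1 / _) => *.
lra.
Qed.

(** The equality case of [sum_sqr_diff_le]. *)
Lemma sum_sqr_diff_alternating (R : realFieldType) (mu : R) (z : nat -> R)
    (m : nat) :
  z 0%N = 0 -> (forall j, z j.+2 + z j = mu * z j.+1) ->
  (forall j, (j <= m)%N -> 0 < z j.+1) ->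
  let v j := (-1) ^+ j * z j in
  \sum_(j < m.+1) (v j.+1 - v j) ^+ 2 =
  (2 + mu) * (\sum_(j < m) v j.+1 ^+ 2) + (1 + z m / z m.+1) * v m.+1 ^+ 2.
Proof.
move=> z0 z_rec z_gt0 v.
have vE j : v j ^+ 2 = z j ^+ 2 by rewrite exprMn sqrr_sign mul1r.
have dvE j : (v j.+1 - v j) ^+ 2 = (z j.+1 + z j) ^+ 2.
  have -> : v j.+1 - v j = (-1) ^+ j.+1 * (z j.+1 + z j).
    by rewrite /v [_ ^+ j.+1]exprS; ring.
  by rewrite exprMn sqrr_sign mul1r.
rewrite vE; under eq_bigr do rewrite dvE.
under [in RHS]eq_bigr do rewrite vE.
(* Once the denominator is cleared, the induction is polynomial and uses only the recurrence. *)
have -> : (1 + z m / z m.+1) * z m.+1 ^+ 2 = z m.+1 ^+ 2 + z m * z m.+1.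
  by field; rewrite gt_eqF // z_gt0.
elim: m {z_gt0} => [|m IHm].
  by rewrite big_ord1 big_ord0 z0; ring.
have zm : z m = mu * z m.+1 - z m.+2 by rewrite -z_rec addrC addKr.
rewrite big_ord_recr {}IHm /= [X in _ = _ * X + _]big_ord_recr /= zm; ring.
Qed.

(* The hypothesis on [z m.+2] extends the eigenvector equation to the last vertex,
   where the corner entries of the two forms are [1 + c] and [1 - d]. *)
Lemma posdef_shifted_min_mx (R : realType) (m : nat) (c d mu t : R)
    (z : nat -> R) :
  z 0%N = 0 -> (forall j, z j.+2 + z j = mu * z j.+1) ->
  (forall j, (j <= m)%N -> 0 < z j.+1) ->
  0 < 2 + mu -> 0 <= c -> d < 1 ->
  z m.+2 = (c - 1 + d * (2 + mu)) * z m.+1 ->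
  posdefmx (shifted_min_mx m.+1 (c * t - d) t) <-> -1 / (2 + mu) <= t.
Proof.
move=> z0 z_rec z_gt0 mu_gt c_ge0 d_lt1 z_bdry.
have zm1_gt0 := z_gt0 m (leqnn m).
(* With this corner coefficient the two sum lemmas compare exactly [S] with [(2 + mu) * Q]. *)
have ratioE : 1 + z m / z m.+1 = (2 + mu) * (1 - d) - c.
  have -> : z m = mu * z m.+1 - z m.+2 by rewrite -z_rec addrC addKr.
  by rewrite z_bdry -mulrBl mulfK ?gt_eqF //; ring.
pose Q w := \sum_(j < m) w j.+1 ^+ 2 + (1 - d) * w m.+1 ^+ 2.
pose S w := \sum_(j < m.+1) (w j.+1 - w j) ^+ 2 + c * w m.+1 ^+ 2.
have qformE (w : nat -> R) : w 0%N = 0 ->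
    (diff_row m.+1 w *m shifted_min_mx m.+1 (c * t - d) t
      *m (diff_row m.+1 w)^T) 0 0 = Q w + t * S w.
  move=> w0; rewrite shifted_min_mx_qform // big_ord_recr /= /Q /S; ring.
have S_ge0 w : 0 <= S w.
  apply: addr_ge0; last by rewrite mulr_ge0 ?sqr_ge0.
  by apply: sumr_ge0 => j _; exact: sqr_ge0.
rewrite posdefmxP ?shifted_min_mx_sym // ler_pdivrMr //; split=> [A_ge0|t_ge x].
  pose v j := (-1) ^+ j * z j.
  have v0 : v 0%N = 0 by rewrite /v z0 mulr0.
  have SQ : S v = (2 + mu) * Q v.
    have := sum_sqr_diff_alternating z0 z_rec z_gt0; rewrite -/v ratioE => vE.
    by rewrite /S vE /Q; ring.
  have Q_gt0 : 0 < Q v.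
    apply: ltr_wpDl; first by apply: sumr_ge0 => j _; exact: sqr_ge0.
    by rewrite mulr_gt0 ?subr_gt0 // exprMn sqrr_sign mul1r exprn_gt0.
  have := A_ge0 (diff_row m.+1 v); rewrite qformE // SQ.
  have -> : Q v + t * ((2 + mu) * Q v) = Q v * (1 + t * (2 + mu)) by ring.
  by rewrite pmulr_rge0 //; lra.
have [w w0 ->] := diff_row_surj x; rewrite qformE //.
have S_le : S w <= (2 + mu) * Q w.
  have := sum_sqr_diff_le z0 z_rec w0 z_gt0; rewrite ratioE /S /Q; lra.
(* Up to the factor [2 + mu], this splits [Q w + t * S w] into two nonnegative terms. *)
have : 0 <= (2 + mu) * Q w - S w + (1 + t * (2 + mu)) * S w.
  by rewrite addr_ge0 ?subr_ge0 // mulr_ge0 //; lra.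
have -> : (2 + mu) * Q w - S w + (1 + t * (2 + mu)) * S w =
  (2 + mu) * (Q w + t * S w) by ring.
by rewrite pmulr_rge0.
Qed.

(** The sequence [sin (j * th)] solves the recurrence with [mu = 2 * cos th], and [n * th < pi]
    keeps it positive up to [j = n]. *)
Lemma posdef_shifted_min_mx_cos (R : realType) (n : nat) (c d th t : R) :
  (1 <= n)%N -> 0 < th -> n%:R * th < pi -> 0 <= c -> d < 1 ->
  sin (n.+1%:R * th) = (c - 1 + d * (2 + 2 * cos th)) * sin (n%:R * th) ->
  posdefmx (shifted_min_mx n (c * t - d) t) <-> -1 / (2 + 2 * cos th) <= t.
Proof.
case: n => // m _ th_gt0 th_lt c_ge0 d_lt1 bdry.
have sin_gt0 j : (j <= m)%N -> 0 < sin (j.+1%:R * th).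
  move=> le_jm; rewrite sin_gt0_pi // mulr_gt0 ?ltr0n //=.
  by apply: le_lt_trans th_lt; rewrite ler_pM2r // ler_nat.
pose z j := sin (j%:R * th).
apply: (@posdef_shifted_min_mx R m c d (2 * cos th) t z) => //; rewrite /z.
- by rewrite mul0r sin0.
- move=> j; have -> : j.+2%:R * th = j.+1%:R * th + th.
    by rewrite [j.+2%:R]mulrS; ring.
  have -> : j%:R * th = j.+1%:R * th - th by rewrite [j.+1%:R]mulrS; ring.
  by rewrite sinD sinB; ring.
have := sin_gt0 0%N isT; rewrite mul1r => sin_th_gt0.
(* Since [sin th] is positive, [cos th] differs from [-1]. *)
have := cos2Dsin2 th; have := cos_geN1 th; have := exprn_gt0 2 sin_th_gt0.
nra.
Qed.

Theorem theorem3p3 (R : realType) (n : nat) (n_ge1 : (1 <= n)%N) :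
  [/\ forall t : R, posdefmx (shifted_min_mx n t t) <->
        -1 / (2 + 2 * cos (pi / (n + 1)%N%:R)) <= t,
      forall t : R, posdefmx (shifted_min_mx n (-1 / 2) t) <->
        -1 / (2 + 2 * cos (pi / (2 * n)%N%:R)) <= t,
      forall t : R, posdefmx (shifted_min_mx n 0 t) <->
        -1 / (2 + 2 * cos (2 * pi / (2 * n + 1)%N%:R)) <= t
    & forall t : R, posdefmx (shifted_min_mx n (2 * t) t) <->
        -1 / (2 + 2 * cos (pi / (2 * n + 1)%N%:R)) <= t].
Proof.
have n_gt0 : 0 < n%:R :> R by rewrite ltr0n.
have pi_gt0 := pi_gt0 R.
have angle (k : nat) (a : R) : (0 < k)%N -> 0 < a ->
    0 < a / k%:R /\ k%:R * (a / k%:R) = a.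
  move=> k_gt0 a_gt0; rewrite divr_gt0 ?ltr0n //; split=> //.
  by rewrite mulrC divfK // pnatr_eq0 -lt0n.
split=> t.
- have [] := angle (n + 1)%N pi; rewrite ?addn1 //.
  set th := _ / _ => th_gt0 thE.
  (* Here [c = 1] and [d = 0]: the boundary equation is [sin ((n + 1) * th) = 0]. *)
  rewrite -[t in shifted_min_mx n t]mul1r -[1 * t]subr0.
  apply: posdef_shifted_min_mx_cos => //; first by move: thE; rewrite mulrS; lra.
  by rewrite thE sinpi; ring.
- have [] := angle (2 * n)%N pi; rewrite ?muln_gt0 //.
  set th := _ / _ => th_gt0; rewrite natrM => thE.
  have nthE : n%:R * th = pi / 2 by lra.
  (* Here [c = 0] and [d = 1 / 2]: the boundary equation reduces to [cos (n * th) * sin th = 0]. *)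
  have -> : -1 / 2 = 0 * t - 1 / 2 by ring.
  apply: posdef_shifted_min_mx_cos => //; try lra.
  have -> : n.+1%:R * th = pi / 2 + th by rewrite mulrS -nthE; ring.
  by rewrite nthE sinD sin_pihalf cos_pihalf; field.
- have [] := angle (2 * n + 1)%N (2 * pi); rewrite ?addn1 //; first lra.
  set th := _ / _ => th_gt0; rewrite mulrS natrM => thE.
  (* Here [c = d = 0]: the sines at [n * th] and [(n + 1) * th] must be opposite, so these angles
     add up to [2 * pi]. *)
  have -> : 0 = 0 * t - 0 by ring.
  apply: posdef_shifted_min_mx_cos => //; try lra.
  have -> : n.+1%:R * th = - (n%:R * th) + pi *+ 2.
    by rewrite mulrS -mulr_natl; lra.
  by rewrite sinD2pi sinN; ring.
- have [] := angle (2 * n + 1)%N pi; rewrite ?addn1 //.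
  set th := _ / _ => th_gt0; rewrite mulrS natrM => thE.
  (* Here [c = 2] and [d = 0]: the two sines must be equal, and the angles add up to [pi]. *)
  rewrite -[2 * t]subr0.
  apply: posdef_shifted_min_mx_cos => //; try lra.
  have -> : n.+1%:R * th = - (n%:R * th - pi) by rewrite mulrS; lra.
  by rewrite sinN sinB sinpi cospi; ring.
Qed.
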